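(* Let $(A,Q)$ be a minimal $\mathcal P_\infty$-algebra and let $n\geq 1$ be an integer. Then the following are equivalent: (1) the truncated operadic Kaledin class $K_A^{\le n}$ is zero; (2) $d_r(e_A)=0$ for $r=2,\dots,n$, where $e_A\in E(A)_2^{0,0}$ is the Euler class of $A$ and $d_r$ is the differential on the $r$-th page of the operadic cohomology spectral sequence $E(A)_r^{p,q}$.
   Context: Setting. $\mathbb K$ is a field of characteristic $0$; dg modules are cochain complexes over $\mathbb K$. $\mathcal P=\mathcal P(E,R)$ is a quadratic Koszul operad over $\mathbb K$, generated by operations $E$ of arity $2$ and cohomological degree $0$, and reduced ($\mathcal P(0)=0$). $\mathcal C=\mathcal P^{\text{¡}}$ is its Koszul dual cooperad, with weight grading $\mathcal C^{(k)}=\mathcal C(k+1)$, $\mathcal C^{(0)}=I$. For a graded module $A$, $\mathcal C(A)$ is the cofree (conilpotent) $\mathcal C$-coalgebra cogenerated by $A[1]$, degrees being normalised so that the cooperations have degree $0$ (for $\mathcal P=\mathrm{Lie}$: the reduced symmetric coalgebra on $A[1]$; for $\mathcal P=\mathrm{Ass}$: the reduced tensor coalgebra on $A[1]$). $\mathcal C(A)^{(i)}$ is the part with $i+1$ tensor factors of $A[1]$. $\mathrm{Coder}(\mathcal C(A))$ is the graded Lie algebra of coderivations of $\mathcal C(A)$, identified via projection to cogenerators with $\prod_{i\ge0}\mathrm{Hom}(\mathcal C(A)^{(i)},A[1])$; the $i$-th factor consists of the coderivations of weight $i$. The bracket is additive in weights. Put $F^p=F^p\mathrm{Coder}(\mathcal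 C(A))=\prod_{i\ge p}\mathrm{Coder}(\mathcal C(A))^{(i)}$. A minimal $\mathcal P_\infty$-algebra $(A,Q)$ is a graded module $A$ (zero differential) with a degree $1$ coderivation $Q=q_1+q_2+\cdots$ of $\mathcal C(A)$ ($q_i$ of weight $i$) with $[Q,Q]=0$. Truncated Kaledin class. $K_A^{\le n}$ is the class of the cocycle $q_2+2q_3+\cdots+(n-1)q_n$ in $H^1(F^1\mathrm{Coder}(\mathcal C(A))/F^{n+1},[Q,-])$. Spectral sequence and Euler class. $E(A)_r^{p,q}$ is the spectral sequence of the complex $(\mathrm{Coder}(\mathcal C(A)),[Q,-])$ filtered by $F^p$; $E(A)_0^{p,q}=\mathrm{Hom}^{p+q}(\mathcal C(A)^{(p)},A[1])$ and $d_r:E_r^{p,q}\to E_r^{p+r,q-r+1}$. The Euler derivation $e_A:A\to A$, $e_A(a)=(\overline a+1)a$ for homogeneous $a$, where $\overline a$ is the degree of $a$ in $A[1]$ (so that $\overline a+1$ is its degree in $A$), is a weight $0$, degree $0$ coderivation, hence an element of $E(A)_1^{0,0}=\mathrm{Hom}^0(A,A)$; it satisfies $d_1(e_A)=0$, and its class in $E(A)_2^{0,0}$ is the Euler class, still written $e_A$. Convention for (2): the condition is understood iteratively: $d_2(e_A)=0$, so $e_A$ defines an element of $E(A)_3^{0,0}$, again denoted $e_A$; then $d_3(e_A)=0$, so that it defines an element of $E(A)_4^{0,0}$; and so on up to $r=n$. *)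

(* Defs.v *)
From HB Require Import structures.
From mathcomp Require Import all_boot all_order all_algebra.
From mathcomp Require Import ring_quotient.
From mathcomp Require Import boolp functions.
From mathcomp Require Import freeg zify.

Set Implicit Arguments.
Unset Strict Implicit.
Unset Printing Implicit Defensive.

Import GRing.Theory.
Local Open Scope ring_scope.
Local Open Scope quotient_scope.

Section Span.
Variables (K : fieldType) (M : lmodType K).

Inductive span (P : M -> Prop) : M -> Prop :=
| span_gen x of P x : span P x
| span_zero : span P 0
| span_lin (a : K) x y of span P x & span P y : span P (a *: x + y).

Definition span_pred (P : M -> Prop) : {pred M} := fun x => `[< span P x >].

Fact span_pred_closed (P : M -> Prop) : submod_closed (span_pred P).
Proof.
split=> [|a x y]; first exact/asboolP/span_zero.
by move=> /asboolP sx /asboolP sy; apply/asboolP/span_lin.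
Qed.

HB.instance Definition _ P :=
  GRing.isSubmodClosed.Build K M (span_pred P) (span_pred_closed P).

End Span.

Section Submod.
Variables (K : fieldType) (M : lmodType K) (P : M -> Prop).

Record submod :=
  Submod { submod_val :> M; submod_valP : submod_val \in span_pred P }.
HB.instance Definition _ := [isSub for submod_val].
HB.instance Definition _ := [Choice of submod by <:].
HB.instance Definition _ := [SubChoice_isSubLmodule of submod by <:].
End Submod.

Section Quot.
Variables (K : fieldType) (M : lmodType K) (P : M -> Prop).

Definition modquot := Quotient.quot (span_pred P).
HB.instance Definition _ := GRing.Zmodule.on modquot.

Definition cls (x : M) : modquot := \pi_(Quotient.quot (span_pred P)) x.
Definition rep (u : modquot) : M := repr (u : Quotient.quot (span_pred P)).

Lemma repK u : cls (rep u) = u.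
Proof. exact: (@reprK _ (Quotient.quot (span_pred P))). Qed.

Lemma cls_eq x y : (cls x = cls y) <-> span P (x - y).
Proof.
split=> [/eqP|h]; last apply/eqP; rewrite /cls piE Quotient.equivE.
  by move/asboolP.
exact/asboolP.
Qed.

Lemma clsD x y : cls (x + y) = cls x + cls y.
Proof. by rewrite /cls piE. Qed.

Definition scaleq (a : K) (u : modquot) : modquot := cls (a *: rep u).

Lemma scaleq_cls a x : scaleq a (cls x) = cls (a *: x).
Proof.
apply/cls_eq; rewrite -scalerBr; have := (cls_eq (rep (cls x)) x).1 (repK _).
move=> h; rewrite -[_ *: _]addr0; apply: span_lin h _; exact: span_zero.
Qed.

Fact scaleqA a b u : scaleq a (scaleq b u) = scaleq (a * b) u.
Proof. by rewrite -[u]repK !scaleq_cls scalerA. Qed.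
Fact scaleq1 : left_id 1 scaleq.
Proof. by move=> u; rewrite -[u]repK scaleq_cls scale1r. Qed.
Fact scaleqDr : right_distributive scaleq +%R.
Proof.
by move=> a u v; rewrite -[u]repK -[v]repK -clsD !scaleq_cls scalerDr clsD.
Qed.
Fact scaleqDl u : {morph scaleq^~ u : a b / a + b}.
Proof. by move=> a b; rewrite -[u]repK !scaleq_cls scalerDl clsD. Qed.

HB.instance Definition _ := GRing.Zmodule_isLmodule.Build K modquot
  scaleqA scaleq1 scaleqDr scaleqDl.

Lemma clsZ a x : cls (a *: x) = a *: cls x.
Proof. by rewrite [RHS]scaleq_cls. Qed.

Lemma cls0 : cls 0 = 0.
Proof. by rewrite -(scale0r 0) clsZ scale0r. Qed.

Lemma cls_sum I (r : seq I) (F : I -> M) :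
  cls (\sum_(i <- r) F i) = \sum_(i <- r) cls (F i).
Proof. by elim/big_rec2: _ => [|i y x _ <-]; rewrite ?cls0 ?clsD. Qed.

End Quot.

Inductive tree (E X : Type) :=
| Leaf of X
| Node of E & tree E X & tree E X.
Arguments Leaf {E X}.

HB.instance Definition _ E X := gen_eqMixin (tree E X).
HB.instance Definition _ E X := gen_choiceMixin (tree E X).

Section Trees.
Variables (E : Type).

Fixpoint leaves X (t : tree E X) : seq X :=
  match t with Leaf x => [:: x] | Node _ l r => leaves l ++ leaves r end.

Fixpoint nodes X (t : tree E X) : nat :=
  match t with Leaf _ => 0 | Node _ l r => (nodes l + nodes r).+1 end.

Fixpoint tbind X Y (f : X -> tree E Y) (t : tree E X) : tree E Y :=
  match t with Leaf x => f x | Node e l r => Node e (tbind f l) (tbind f r) end.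

Definition tmap X Y (f : X -> Y) : tree E X -> tree E Y :=
  tbind (fun x => Leaf (f x)).

(* The partial composite t o_a u. *)
Definition graft (t : tree E nat) (a : nat) (u : tree E nat) : tree E nat :=
  tbind (fun b => if b == a then u else Leaf b) t.

Fixpoint subtrees X (t : tree E X) : seq (tree E X) :=
  t :: match t with Leaf _ => [::] | Node _ l r => subtrees l ++ subtrees r end.

(* t is a tree whose leaves are labelled bijectively by S. *)
Definition multilinear (S : seq nat) (t : tree E nat) : bool :=
  uniq S && perm_eq (leaves t) S.

End Trees.

(* A formal linear combination of trees. *)
Notation fsum K E X := (seq (K * tree E X)%type).

Definition fmap (K E X E' Y : Type) (f : tree E X -> tree E' Y)
    (s : fsum K E X) : fsum K E' Y :=
  [seq (kt.1, f kt.2) | kt <- s].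

Definition sgnz (K : fieldType) (i : int) : K := (-1) ^+ `|i|%N.

Record S2module (K : fieldType) := MkS2module {
  S2_mod :> lmodType K;
  S2_swap : {linear S2_mod -> S2_mod};
  S2_swapK : involutive S2_swap }.

(* E (x) sgn_2 *)
Section Twist.
Variables (K : fieldType) (E : S2module K).

Definition twist_swap : {linear E -> E} := -%R \o S2_swap E.
Fact twist_swapK : involutive twist_swap.
Proof. by move=> e /=; rewrite linearN opprK S2_swapK. Qed.
Definition twist : S2module K := MkS2module twist_swapK.
End Twist.

(* mag deg base is the free graded module with binary operations e in E (of   *)
(* degree 0, with e(x,y) = (-1)^{|x||y|} (e.tau)(y,x)) generated by the       *)
(* graded set X, modulo the ideal generated by base.                          *)
Section Mag.
Variables (K : fieldType) (E : S2module K) (X : Type) (deg : X -> int).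
Variable base : fsum K E X -> Prop.

Definition tdeg (t : tree E X) : int := \sum_(x <- leaves t) deg x.

Inductive mag_rel : fsum K E X -> Prop :=
| mag_base s of base s : mag_rel s
| mag_op (k : K) (e f : E) l r :
    mag_rel [:: (1, Node (k *: e + f) l r); (- k, Node e l r); (- 1, Node f l r)]
| mag_swap (e : E) l r :
    mag_rel [:: (1, Node e l r);
                (- sgnz K (tdeg l * tdeg r), Node (S2_swap E e) r l)]
| mag_ctxl (e : E) s r of mag_rel s : mag_rel (fmap (fun l => Node e l r) s)
| mag_ctxr (e : E) l s of mag_rel s : mag_rel (fmap (fun r => Node e l r) s).

Definition mag : Type :=
  modquot (fun D : {freeg (tree E X) / K} =>
             exists2 s, mag_rel s & D = [freeg s]).
HB.instance Definition _ := GRing.Lmodule.on mag.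

Definition tgen (t : tree E X) : mag := cls _ << t >>.

Definition fval (s : fsum K E X) : mag := \sum_(kt <- s) kt.1 *: tgen kt.2.

(* Linear extension of a function on trees; meaningful when it respects the   *)
(* relations, see mag_liftP.                                                  *)
Definition mag_lift (M : lmodType K) (f : tree E X -> M) (x : mag) : M :=
  fglift f (rep x).

Definition node (e : E) (x y : mag) : mag :=
  mag_lift (fun l => mag_lift (fun r => tgen (Node e l r)) y) x.

Definition tspan (P : tree E X -> Prop) : mag -> Prop :=
  span (fun x => exists2 t, P t & x = tgen t).

Lemma fglift_linear (M : lmodType K) (f : tree E X -> M) : linear (fglift f).
Proof.
have hD : {morph fglift f : x y / x - y} by exact: lift_is_additive.
have h0 : fglift f 0 = 0 by rewrite -(subrr 0) hD subrr.
have hN : {morph fglift f : x / - x} by move=> x; rewrite -sub0r hD h0 sub0r.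
have hA : {morph fglift f : x y / x + y}.
  by move=> x y; rewrite -[y in LHS]opprK hD hN opprK.
move=> a D1 D2; rewrite hA; congr (_ + _); elim/freeg_ind_dom0: D1 => [|k t D _ _ IH].
  by rewrite scaler0 h0 scaler0.
rewrite scalerDr !hA IH scalerDr liftU; congr (_ + _).
suff -> : a *: << k *g t >> = << a * k *g t >> :> {freeg (tree E X) / K}.
  by rewrite liftU scalerA.
by apply/eqP/freeg_eqP => u; rewrite coeff_fgscale !coeffU mulrA.
Qed.

Lemma freeg_sum (s : fsum K E X) :
  [freeg s] = \sum_(kt <- s) kt.1 *: << kt.2 >> :> {freeg (tree E X) / K}.
Proof.
apply/eqP/freeg_eqP => u; rewrite coeff_Freeg raddf_sum /= /precoeff big_mkcond.
apply: eq_bigr => kt _; rewrite coeff_fgscale coeffU mul1r.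
by case: eqP => _; rewrite ?mulr1 ?mulr0.
Qed.

Lemma fvalE s : fval s = cls _ [freeg s].
Proof.
by rewrite freeg_sum cls_sum; apply: eq_bigr => kt _; rewrite clsZ.
Qed.

Lemma fval_rel s : mag_rel s -> fval s = 0.
Proof.
move=> hs; rewrite fvalE -[RHS](cls0 _); apply/cls_eq; rewrite subr0.
by apply: span_gen; exists s.
Qed.

Lemma mag_ind (P : mag -> Prop) :
  P 0 -> (forall k t x, P x -> P (k *: tgen t + x)) -> forall x, P x.
Proof.
move=> P0 PS x; rewrite -[x]repK; elim/freeg_ind_dom0: (rep x) => [|k t D _ _ IH].
  by rewrite cls0.
rewrite clsD; have -> : << k *g t >> = k *: << t >> :> {freeg (tree E X) / K}.
  by apply/eqP/freeg_eqP => u; rewrite coeff_fgscale !coeffU mul1r.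
by rewrite clsZ; exact: PS.
Qed.

Section Lift.
Variables (M : lmodType K) (f : tree E X -> M).
Hypothesis f_rel : forall s, mag_rel s -> \sum_(kt <- s) kt.1 *: f kt.2 = 0.

Lemma mag_lift_cls D : mag_lift f (cls _ D) = fglift f D.
Proof.
pose g : {linear {freeg (tree E X) / K} -> M} := HB.pack (fglift f)
  (GRing.isLinear.Build K {freeg (tree E X) / K} M *:%R _ (fglift_linear f)).
suff h D' : span (fun D => exists2 s, mag_rel s & D = [freeg s]) D' -> g D' = 0.
  by apply/eqP; rewrite -subr_eq0 -(linearB g) h //; apply/cls_eq; exact: repK.
elim=> [x [s hs ->]||a x y _ ihx _ ihy].
- by rewrite /= fglift_Freeg; exact: f_rel.
- by rewrite linear0.
by rewrite linearP ihx ihy scaler0 addr0.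
Qed.

Lemma mag_liftP : linear (mag_lift f) /\ forall t, mag_lift f (tgen t) = f t.
Proof.
split=> [a x y|t]; last by rewrite mag_lift_cls liftU scale1r.
by rewrite -[x]repK -[y]repK -clsZ -clsD !mag_lift_cls fglift_linear.
Qed.
End Lift.

Lemma mag_ext (M : lmodType K) (f g : mag -> M) :
  linear f -> linear g -> (forall t, f (tgen t) = g (tgen t)) -> f =1 g.
Proof.
have lin0 (h : mag -> M) : linear h -> h 0 = 0.
  by move=> lh; have := lh (-1) 0 0; rewrite scaler0 addr0 scaleN1r addNr.
move=> lf lg fg; elim/mag_ind => [|k t x IH]; last by rewrite lf lg fg IH.
by rewrite !lin0.
Qed.

Let node_relr e l s : mag_rel s ->
  \sum_(kt <- s) kt.1 *: tgen (Node e l kt.2) = 0.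
Proof. by move=> /(mag_ctxr e l)/fval_rel; rewrite /fval big_map. Qed.

Let node_rell e y s : mag_rel s ->
  \sum_(kt <- s) kt.1 *: mag_lift (fun r => tgen (Node e kt.2 r)) y = 0.
Proof.
move=> hs; pose g y := \sum_(kt <- s) kt.1 *: mag_lift (fun r => tgen (Node e kt.2 r)) y.
apply: (@mag_ext _ g (fun=> 0)) y => [a x y|a x y|t].
- rewrite /g scaler_sumr -big_split; apply: eq_bigr => kt _ /=.
  rewrite (mag_liftP (@node_relr e kt.2)).1 scalerDr !scalerA.
  by rewrite [a * _]mulrC.
- by rewrite scaler0 addr0.
move: (fval_rel (mag_ctxl e t hs)); rewrite /fval big_map /= => <-.
by apply: eq_bigr => kt _; rewrite (mag_liftP (@node_relr e kt.2)).2.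
Qed.

Lemma node_tgen e l r : node e (tgen l) (tgen r) = tgen (Node e l r).
Proof.
by rewrite /node (mag_liftP (@node_rell e _)).2 (mag_liftP (@node_relr e l)).2.
Qed.

Lemma node_linearl e y : linear (fun x => node e x y).
Proof. exact: (mag_liftP (@node_rell e y)).1. Qed.

Lemma node_linearr e x : linear (node e x).
Proof.
move=> a y z; pose g x := node e x (a *: y + z).
apply: (@mag_ext _ g (fun x => a *: node e x y + node e x z)) x => [b u v|b u v|t].
- exact: node_linearl.
- by rewrite !node_linearl !scalerDr !scalerA addrACA [a * b]mulrC.
by rewrite /g /node !(mag_liftP (@node_rell e _)).2 (mag_liftP (@node_relr e t)).1.
Qed.

End Mag.
Arguments mag {K} E {X} deg base.
Arguments tgen {K E X} deg base t.
Arguments fval {K E X} deg base s.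
Arguments node {K E X deg base} e x y.

(* T(E)(S), for the free operad T(E) and S a set of labels, is the span in    *)
(* tree_mod E of the trees with leaves labelled bijectively by S. It is also  *)
(* the underlying module of the cofree conilpotent cooperad on E.             *)
Definition tree_mod (K : fieldType) (E : S2module K) : lmodType K :=
  mag E (fun _ : nat => 0) (fun _ => False).

Definition has_arity (K E : Type) (S : seq nat) (s : fsum K E nat) : bool :=
  all (fun kt => multilinear S kt.2) s.

Notation I3 := [:: 0%N; 1%N; 2%N].

(* Quadratic data (E, R): an S_2-module E and a sub-S_3-module R of T(E)(3).  *)
Record quadratic_data (K : fieldType) := MkQuadraticData {
  qE : S2module K;
  qR : tree_mod qE -> Prop;
  qR_arity : forall x, qR x -> tspan (multilinear I3) x;
  qR0 : qR 0;
  qR_lin : forall (a : K) x y, qR x -> qR y -> qR (a *: x + y);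
  qR_sym : forall (f : nat -> nat) (s : fsum K qE nat),
    has_arity I3 s -> perm_eq (map f I3) I3 ->
    qR (fval _ _ s) -> qR (fval _ _ (fmap (tmap f) s)) }.

Section Operad.
Variables (K : fieldType) (P : quadratic_data K).
Notation E := (qE P).

(* The free P-algebra on generators x_0, x_1, ...; the operad                 *)
(* P = T(E)/(R) is recovered as P(S) = the part multilinear in the x_i, i in  *)
(* S.                                                                         *)
Definition operad_rel (s : fsum K E nat) : Prop :=
  exists (c : fsum K E nat) (v : nat -> tree E nat),
    [/\ has_arity I3 c, qR (fval _ _ c) & s = fmap (tbind v) c].

Definition free_alg : lmodType K := mag E (fun _ : nat => 0) operad_rel.

(* The Koszul dual cooperad is desuspended so as to sit in degree 0, hence    *)
(* cogenerated by E' = E (x) sgn_2 instead of sE.                             *)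
Notation E' := (twist E).

(* The Koszul sign of sorting the word w, its letter a having degree d a.     *)
Fixpoint koszul_sign (d : nat -> int) (w : seq nat) : K :=
  match w with
  | [::] => 1
  | a :: w' => (\prod_(b <- w' | (b < a)%N) sgnz K (d a * d b)) * koszul_sign d w'
  end.

(* The isomorphism T(E)(3) (x) sgn_3 = T(E')(3) given by the suspension of    *)
(* operads: each leaf and each vertex counts as odd, so that composition in   *)
(* the second input carries a sign with respect to composition in the first.  *)
Definition comb_sign (t : tree E nat) : K :=
  match t with Node _ (Leaf _) (Node _ _ _) => - 1 | _ => 1 end.

Definition susp (s : fsum K E nat) : fsum K E' nat :=
  [seq (kt.1 * comb_sign kt.2 * koszul_sign (fun=> 1) (leaves kt.2), kt.2 : tree E' nat)
     | kt <- s].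

Definition corel (x : tree_mod E') : Prop :=
  exists s : fsum K E nat,
    [/\ has_arity I3 s, qR (fval _ _ s) & x = fval _ _ (susp s)].

(* c o_a d *)
Definition fgraft (c : fsum K E' nat) (a : nat) (d : fsum K E' nat) : fsum K E' nat :=
  [seq (kt.1 * lu.1, graft kt.2 a lu.2) | kt <- c, lu <- d].

(* Some vertex (or leaf) of t has U as its set of descendant leaves. *)
Definition splits (U : seq nat) (t : tree E' nat) : bool :=
  has (fun u => perm_eq (leaves u) U) (subtrees t).

(* Sub-cooperads D of the cofree cooperad. For U a part of S, the             *)
(* infinitesimal decomposition T(E')(S) -> T(E')((S \ U) + a) (x) T(E')(U)    *)
(* cuts every tree at the vertex above U, and kills the trees without such a  *)
(* vertex; sub_cut says that it maps D(S) to D((S \ U) + a) (x) D(U).         *)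
Record subcooperad (D : seq nat -> tree_mod E' -> Prop) : Prop := {
  sub_arity : forall S x, D S x -> tspan (multilinear S) x;
  sub_zero : forall S, D S 0;
  sub_lin : forall S (k : K) x y, D S x -> D S y -> D S (k *: x + y);
  sub_unit : forall a, D [:: a] (tgen _ _ (Leaf a));
  sub_perm : forall S S' x, perm_eq S S' -> D S x -> D S' x;
  sub_relabel : forall S (f : nat -> nat) s, {in S &, injective f} ->
    has_arity S s -> D S (fval _ _ s) -> D (map f S) (fval _ _ (fmap (tmap f) s));
  sub_cut : forall S U a x, uniq S -> uniq U -> {subset U <= S} -> U != [::] ->
    a \notin S -> D S x ->
    let S' := a :: [seq b <- S | b \notin U] in
    exists (r : seq (fsum K E' nat * fsum K E' nat)) (y : fsum K E' nat),
    [/\ forall c d, (c, d) \in r ->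
          [/\ has_arity S' c, D S' (fval _ _ c), has_arity U d & D U (fval _ _ d)],
        has_arity S y, all (fun kt => ~~ splits U kt.2) y &
        x = fval _ _ y + \sum_(cd <- r) fval _ _ (fgraft cd.1 a cd.2)] }.

(* The quadratic cooperad C(E', R'): the largest sub-cooperad of the cofree   *)
(* cooperad whose weight 2 part lies in the (suspended) relations.            *)
Definition koszul_dual (S : seq nat) (x : tree_mod E') : Prop :=
  exists D, [/\ subcooperad D, forall y, D I3 y -> corel y & D S x].

Section Cofree.
Variable A : int -> lmodType K.

(* Homogeneous elements of A, with their degree in A[1]. *)
Definition homog := {i : int & A i}.
Definition sdeg (x : homog) : int := tag x - 1.

Definition leaf_rel (s : fsum K E' homog) : Prop :=
  exists (i : int) (k : K) (u w : A i),
    s = [:: (1, Leaf (Tagged A (k *: u + w))); (- k, Leaf (Tagged A u));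
            (- 1, Leaf (Tagged A w))].

(* T^c(E')(A[1]): trees with vertices in E' and leaves in A[1]. *)
Definition cotree : lmodType K := mag E' sdeg leaf_rel.

Definition dleaf (x : homog) : cotree := tgen _ _ (Leaf x).

(* c (x) (v_0 (x) ... (x) v_(m-1)) as an element of T^c(E')(A[1]). *)
Definition ceval (c : fsum K E' nat) (v : nat -> homog) : cotree :=
  \sum_(kt <- c) (kt.1 * koszul_sign (sdeg \o v) (leaves kt.2))
                   *: tgen _ _ (tmap v kt.2).

(* C(A) = sum over m of (C(m) (x) A[1]^m)_{S_m}, embedded in T^c(E')(A[1]).   *)
Definition cofree_gen (x : cotree) : Prop :=
  exists (m : nat) (c : fsum K E' nat) (v : nat -> homog),
    [/\ has_arity (iota 0 m) c, koszul_dual (iota 0 m) (fval _ _ c) & x = ceval c v].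

Definition cofree := submod cofree_gen.
HB.instance Definition _ := GRing.Lmodule.on cofree.

(* C(A)^(i), the elements of degree d, and the kernel of the projection to    *)
(* the cogenerators A[1] = C(A)^(0).                                          *)
Definition weight (i : nat) : cotree -> Prop := tspan (fun t => nodes t = i).
Definition hdeg (d : int) : cotree -> Prop := tspan (fun t => tdeg sdeg t = d).
Definition ker_pr : cotree -> Prop := tspan (fun t => (0 < nodes t)%N).

(* Since T^c(E')(V) = V + (E' (x) T^c(E')(V)^2)_{S_2}, writing                *)
(* x = v + sum_j e_j(y_j, z_j) with v in V exhibits the value                 *)
(* sum_j e_j (x) y_j (x) z_j of the binary cooperations on x. As C is         *)
(* cogenerated by E', these determine the whole C-coalgebra structure.        *)
Definition cotensor : Type := (E' * int * cofree * cofree)%type.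

Definition cot_val (p : cotensor) : cotree :=
  let: (e, _, y, z) := p in node e (val y) (val z).

Definition cot_der (k : int) (D : cofree -> cofree) (p : cotensor) : cotree :=
  let: (e, d, y, z) := p in
  node e (val (D y)) (val z) + sgnz K (k * d) *: node e (val y) (val (D z)).

Definition co_leibniz (k : int) (D : cofree -> cofree) : Prop :=
  forall (x : cofree) (v : cotree) (r : seq cotensor),
    weight 0 v ->
    (forall e d y z, (e, d, y, z) \in r -> hdeg d (val y)) ->
    val x = v + \sum_(p <- r) cot_val p ->
    weight 0 (val (D x) - \sum_(p <- r) cot_der k D p).

(* Degree k coderivations of C(A). *)
Definition coder (k : int) (D : cofree -> cofree) : Prop :=
  [/\ linear D, forall d x, hdeg d (val x) -> hdeg (d + k) (val (D x))
    & co_leibniz k D].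

(* Coder(C(A)) is identified with prod_i Hom(C(A)^(i), A[1]) via D |-> pr D.  *)
Definition has_weight (i : nat) (D : cofree -> cofree) : Prop :=
  forall (j : nat) x, j != i -> weight j (val x) -> ker_pr (val (D x)).

Definition Fcoder (p k : int) (D : cofree -> cofree) : Prop :=
  coder k D /\
  forall (i : nat) x, i%:Z < p -> weight i (val x) -> ker_pr (val (D x)).

(* Graded commutator of endomorphisms of degrees k and l. *)
Definition bracket (k l : int) (D D' : cofree -> cofree) : cofree -> cofree :=
  fun x => D (D' x) - sgnz K (k * l) *: D' (D x).

(* Q = q_1 + q_2 + ... in prod_i Hom(C(A)^(i), A[1]). *)
Record minimal_Pinfty := MkMinimalPinfty {
  pQ : cofree -> cofree;
  pq : nat -> cofree -> cofree;
  pQ_coder : coder 1 pQ;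
  pq_coder : forall i, coder 1 (pq i) /\ has_weight i (pq i);
  pq0 : pq 0 = 0;
  pQ_sum : forall (i : nat) x, weight i (val x) -> ker_pr (val (pQ x) - val (pq i x));
  pQ_MC : bracket 1 1 pQ pQ = 0 }.

(* The Euler derivation e_A, extended as a coderivation: it multiplies a tree *)
(* by the sum of the degrees in A of its leaves.                              *)
Definition tdegA (t : tree E' homog) : int := \sum_(x <- leaves t) (sdeg x + 1).

Definition eulerT : cotree -> cotree :=
  mag_lift (fun t => (tdegA t)%:~R *: tgen _ _ t).

Lemma euler_rel s : mag_rel sdeg leaf_rel s ->
  \sum_(kt <- s) kt.1 *: ((tdegA kt.2)%:~R *: tgen sdeg leaf_rel kt.2) = 0.
Proof.
move=> hs; suff [w hw] : exists w, all (fun kt => tdegA kt.2 == w) s.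
  transitivity (w%:~R *: fval sdeg leaf_rel s); last by rewrite fval_rel ?scaler0.
  rewrite /fval scaler_sumr big_seq [RHS]big_seq.
  by apply: eq_bigr => kt /(allP hw)/eqP ->; rewrite !scalerA mulrC.
have tdegN e l r : tdegA (Node e l r) = tdegA l + tdegA r.
  by rewrite /tdegA /= big_cat.
elim: s / hs => [s [i [k [u [w ->]]]]|k e f l r|e l r|e s r _ [w hw]|e l s _ [w hw]].
- by exists (i - 1 + 1); rewrite /= /tdegA /= !big_seq1 /sdeg /= !eqxx.
- by exists (tdegA l + tdegA r); rewrite /= !tdegN !eqxx.
- by exists (tdegA l + tdegA r); rewrite /= !tdegN [X in _ && ((X == _) && _)]addrC !eqxx.
- exists (w + tdegA r); rewrite all_map; apply: sub_all hw => kt /= /eqP <-.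
  by rewrite tdegN.
exists (tdegA l + w); rewrite all_map; apply: sub_all hw => kt /= /eqP <-.
by rewrite tdegN.
Qed.

Lemma eulerT_linear : linear eulerT.
Proof. exact: (mag_liftP euler_rel).1. Qed.

Lemma eulerT_tgen t : eulerT (tgen _ _ t) = (tdegA t)%:~R *: tgen _ _ t.
Proof. exact: (mag_liftP euler_rel).2. Qed.

Lemma eulerT_node e x y :
  eulerT (node e x y) = node e (eulerT x) y + node e x (eulerT y).
Proof.
have L1 := node_linearl; have L2 := node_linearr.
have lin0 (f : cotree -> cotree) : linear f -> f 0 = 0.
  by move=> lf; have := lf (-1) 0 0; rewrite scaler0 addr0 scaleN1r addNr.
have linZ (f : cotree -> cotree) a u : linear f -> f (a *: u) = a *: f u.
  by move=> lf; rewrite -[a *: u]addr0 lf lin0 // addr0.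
have LE := eulerT_linear.
apply: (mag_ext (f := fun x => eulerT (node e x y))
         (g := fun x => node e (eulerT x) y + node e x (eulerT y))) x.
- by move=> a u v; rewrite L1 LE.
- move=> a u v /=; rewrite LE !L1 scalerDr addrACA //.
move=> l; apply: (mag_ext (f := fun y => eulerT (node e (tgen _ _ l) y))
   (g := fun y => node e (eulerT (tgen _ _ l)) y + node e (tgen _ _ l) (eulerT y))) y.
- by move=> a u v; rewrite L2 LE.
- by move=> a u v /=; rewrite LE !L2 scalerDr addrACA.
move=> r; rewrite !(node_tgen, eulerT_tgen).
have nodeZl a u z : node e (a *: u) z = a *: node e u z :> cotree.
  by apply: (linZ (fun x => node e x z)); exact: node_linearl.
have nodeZr a u z : node e u (a *: z) = a *: node e u z :> cotree.
  by apply: (linZ (node e u)); exact: node_linearr.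
rewrite nodeZl nodeZr node_tgen -scalerDl -intrD; congr (_%:~R *: _).
by rewrite /tdegA /= big_cat.
Qed.

Lemma perm_tdegA m (c : fsum K E' nat) (v : nat -> homog) kt : has_arity (iota 0 m) c -> kt \in c ->
  tdegA (tmap v kt.2) = \sum_(j <- iota 0 m) (sdeg (v j) + 1).
Proof.
move=> /allP hc /hc /andP [_ /(perm_big _) <-]; rewrite /tdegA.
suff -> : leaves (tmap v kt.2) = [seq v j | j <- leaves kt.2] by rewrite big_map.
by elim: kt.2 => //= e l -> r ->; rewrite map_cat.
Qed.

Fact eulerT_cofree (x : cofree) : eulerT (val x) \in span_pred cofree_gen.
Proof.
case: x => x /= /asboolP; elim=> [{}x [m [c [v [hc kc ->]]]]||a {}x y _ hx _ hy].
- have -> : eulerT (ceval c v) =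
      (\sum_(j <- iota 0 m) (sdeg (v j) + 1))%:~R *: ceval c v.
    have lin0 : eulerT 0 = 0.
      have := eulerT_linear (-1) 0 0.
      by rewrite scaler0 addr0 scaleN1r addNr.
    rewrite /ceval scaler_sumr big_seq [RHS]big_seq.
    elim/big_rec2: _ => [//|kt u w hkt <-].
    rewrite eulerT_linear eulerT_tgen (perm_tdegA v hc hkt) !scalerA.
    by rewrite [X in X *: _ + _ = _]mulrC.
  by apply/rpredZ/asboolP/span_gen; exists m, c, v.
- have -> : eulerT 0 = 0; last exact: rpred0.
  by have := eulerT_linear (-1) 0 0; rewrite scaler0 addr0 scaleN1r addNr.
by rewrite eulerT_linear; apply: rpredD => //; exact: rpredZ.
Qed.

Definition euler (x : cofree) : cofree := Submod (eulerT_cofree x).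

Lemma eulerT_tspan (R : tree E' homog -> Prop) x :
  tspan R x -> tspan R (eulerT x).
Proof.
have e0 : eulerT 0 = 0.
  by have := eulerT_linear (-1) 0 0; rewrite scaler0 addr0 scaleN1r addNr.
elim=> [{}x [t Rt ->]||a {}x y _ hx _ hy].
- rewrite eulerT_tgen -[X in tspan _ X]addr0; apply: span_lin (span_zero _).
  by apply: span_gen; exists t.
- by rewrite e0; exact: span_zero.
by rewrite eulerT_linear; exact: span_lin.
Qed.

Lemma euler_coder : [/\ coder 0 euler, has_weight 0 euler &
  forall (a : homog) (x : cofree), val x = dleaf a ->
    val (euler x) = (sdeg a + 1)%:~R *: dleaf a].
Proof.
have e0 : eulerT 0 = 0.
  by have := eulerT_linear (-1) 0 0; rewrite scaler0 addr0 scaleN1r addNr.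
have eD u w : eulerT (u + w) = eulerT u + eulerT w.
  by have := eulerT_linear 1 u w; rewrite !scale1r.
split; first split.
- by move=> a x y; apply: val_inj; rewrite /= eulerT_linear.
- by move=> d x hx; rewrite addr0; exact: eulerT_tspan.
- move=> x v r hv _ /= ->; rewrite eD.
  suff -> : eulerT (\sum_(p <- r) cot_val p) = \sum_(p <- r) cot_der 0 euler p.
    by rewrite addrK; exact: eulerT_tspan.
  elim/big_rec2: _ => [//|[[[e d] y] z] u w _ <-].
  rewrite eD; congr (_ + _).
  by rewrite /= eulerT_node mul0r /sgnz absz0 expr0 scale1r.
- move=> j x j0 hx; rewrite /=; apply: eulerT_tspan; elim: hx => [y [t jt ->]||a y z _ hy _ hz].
  + by apply: span_gen; exists t => //; rewrite jt lt0n.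
  + exact: span_zero.
  exact: span_lin.
by move=> a x /= ->; rewrite eulerT_tgen /tdegA /= big_seq1.
Qed.

End Cofree.

(* A module concentrated in degree 0. *)
Definition conc0 (M : lmodType K) (i : int) : lmodType K :=
  match i with Posz 0 => M | _ => 'rV[K]_0 end.

Notation PP := (conc0 free_alg).

Definition free_gen (t : tree E nat) : homog PP :=
  Tagged PP (tgen _ _ t : PP 0).

(* (C o P)(n), as the multilinear part of C(P(x_0, ..., x_(n-1))). *)
Definition koszul_chain (n : nat) : cofree PP -> Prop :=
  span (fun x => exists (m : nat) (c : fsum K E' nat) (t : nat -> tree E nat),
    [/\ has_arity (iota 0 m) c, koszul_dual (iota 0 m) (fval _ _ c),
        perm_eq (flatten [seq leaves (t j) | j <- iota 0 m]) (iota 0 n) &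
        val x = ceval c (free_gen \o t)]).

(* d_kappa is the coderivation extending the binary products of the free      *)
(* P-algebra.                                                                 *)
Definition koszul_diff (d : cofree PP -> cofree PP) : Prop :=
  [/\ coder 1 d, has_weight 1 d &
      forall (x : cofree PP) (e : E) (a b : free_alg),
        val x = node (e : E') (dleaf (Tagged PP (a : PP 0))) (dleaf (Tagged PP (b : PP 0))) ->
        ker_pr (val (d x) - dleaf (Tagged PP (node e a b : PP 0)))].

(* P is Koszul when the Koszul complex C o_kappa P is acyclic, i.e. exact in  *)
(* every arity n >= 2 (in arity 1 it is I).                                   *)
Definition koszul : Prop :=
  exists2 d, koszul_diff d &
    forall (n : nat) x, (2 <= n)%N -> koszul_chain n x -> d x = 0 ->
      exists2 y, koszul_chain n y & d y = x.

End Operad.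

(* The spectral sequence of a filtered complex, given by the submodules       *)
(* F p k of U (filtration p, degree k) and the differentials d k from degree  *)
(* k to degree k + 1.                                                         *)
Section FilteredComplex.
Variables (K : fieldType) (U : lmodType K).
Variables (F : int -> int -> U -> Prop) (d : int -> U -> U).

(* Z_r^{p,q} and B_r^{p,q} = Z_{r-1}^{p+1,q-1} + d Z_{r-1}^{p-r+1,q+r-2}      *)
Definition cyc (r : nat) (p q : int) (x : U) : Prop :=
  F p (p + q) x /\ F (p + r%:Z) (p + q + 1) (d (p + q) x).

Definition bnd (r : nat) (p q : int) (x : U) : Prop :=
  exists y z, [/\ cyc r.-1 (p + 1) (q - 1) y,
    cyc r.-1 (p - r%:Z + 1) (q + r%:Z - 2) z & x = y + d (p + q - 1) z].

(* E_r^{p,q} = Z_r^{p,q} / B_r^{p,q}, inside U / B_r^{p,q}. *)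
Definition page (r : nat) (p q : int) : lmodType K := modquot (bnd r p q).

Definition page_cls r p q (x : U) : page r p q := cls (bnd r p q) x.

(* d_r [x] = [d x], see page_diffE. *)
Definition page_diff r p q (u : page r p q) : page r (p + r%:Z) (q - r%:Z + 1) :=
  page_cls r (p + r%:Z) (q - r%:Z + 1) (d (p + q) (rep u)).

(* w in E_{r+1} is the class of the d_r-cycle u in E_r, under the             *)
(* isomorphism E_{r+1} = H(E_r, d_r).                                         *)
Definition page_next r p q (u : page r p q) (w : page r.+1 p q) : Prop :=
  exists z, [/\ cyc r.+1 p q z, u = page_cls r p q z & w = page_cls r.+1 p q z].

(* F^a / F^b is a quotient complex; its cohomology in degree k is             *)
(* {x in F a k | d x in F b (k+1)} / (d (F a (k-1)) + F b k), inside          *)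
(* U / (d (F a (k-1)) + F b k).                                               *)
Definition strip_bnd (a b k : int) (x : U) : Prop :=
  exists y z, [/\ F a (k - 1) y, F b k z & x = d (k - 1) y + z].
Definition strip_H (a b k : int) : lmodType K := modquot (strip_bnd a b k).
Definition strip_cls a b k (x : U) : strip_H a b k := cls (strip_bnd a b k) x.

Hypothesis F0 : forall p k, F p k 0.
Hypothesis d_lin : forall k, linear (d k).
Hypothesis dd : forall p k x, F p k x -> d (k + 1) (d k x) = 0.

Lemma page_diffE r p q x :
  page_diff (page_cls r p q x) = page_cls _ _ _ (d (p + q) x).
Proof.
have d0 k : d k 0 = 0.
  by have := d_lin k (-1) 0 0; rewrite scaler0 addr0 scaleN1r addNr.
have dB k u v : d k (u - v) = d k u - d k v.
  by have := d_lin k (-1) v u; rewrite !scaleN1r [- v + u]addrC => ->; rewrite addrC.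
apply/cls_eq; rewrite -dB.
have := (cls_eq (bnd r p q) _ _).1 (repK (page_cls r p q x)).
elim=> [_ [y [z [hy hz ->]]]||a u v _ hu _ hv]; last 2 first.
- by rewrite d0; exact: span_zero.
- by rewrite d_lin; exact: span_lin.
apply: span_gen; exists 0, y; split.
- by split; rewrite ?d0.
- have -> : p + r%:Z - r%:Z + 1 = p + 1 by lia.
  by have -> : q - r%:Z + 1 + r%:Z - 2 = q - 1 by lia.
rewrite add0r -[y in LHS]scale1r d_lin scale1r.
have -> : p + r%:Z + (q - r%:Z + 1) - 1 = p + q by lia.
have -> : d (p + q) (d (p + q - 1) z) = 0; last by rewrite addr0.
case: hz => hz _; have e : p - r%:Z + 1 + (q + r%:Z - 2) = p + q - 1 by lia.
by rewrite e in hz; have := dd hz; rewrite subrK.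
Qed.

End FilteredComplex.

Section Classes.
Variables (K : fieldType) (P : quadratic_data K) (A : int -> lmodType K).
Variable Q : minimal_Pinfty P A.

(* [Q, -] in degree k *)
Definition adQ (k : int) : (cofree P A -> cofree P A) -> (cofree P A -> cofree P A) :=
  bracket 1 k (pQ Q).

(* The operadic cohomology spectral sequence E(A)_r^{p,q}. *)
Definition EA (r : nat) (p q : int) : lmodType K := page (@Fcoder K P A) adQ r p q.
Definition dEA (r : nat) (p q : int) : EA r p q -> EA r (p + r%:Z) (q - r%:Z + 1) :=
  @page_diff _ _ _ _ r p q.

Lemma Fcoder0 p k : @Fcoder K P A p k 0.
Proof.
have node0l e (y : cotree P A) : node e 0 y = 0.
  by have := node_linearl e y (-1) 0 0; rewrite scaler0 addr0 scaleN1r addNr.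
have node0r e (y : cotree P A) : node e y 0 = 0.
  by have := node_linearr e y (-1) 0 0; rewrite scaler0 addr0 scaleN1r addNr.
split=> [|i x _ _]; last exact: span_zero.
split=> [a x y|d x _|x v r _ _ _]; try exact: span_zero.
  by rewrite /= scaler0 addr0.
rewrite big1 ?subr0; first exact: span_zero.
by move=> [[[e d] y] z] _; rewrite /= node0l node0r scaler0 addr0.
Qed.

Lemma adQ_linear k : linear (adQ k).
Proof.
have [linQ _ _] := pQ_coder Q.
move=> a D D'; apply/funext => x; rewrite /adQ /bracket /= linQ.
rewrite -[(a *: D + D') (pQ Q x)]/(a *: D (pQ Q x) + D' (pQ Q x)).
rewrite scalerDr opprD addrACA scalerBr !scalerA [a * _]mulrC.
by [].
Qed.

Lemma adQ_adQ (charK : [pchar K] =i pred0) p k D :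
  @Fcoder K P A p k D -> adQ (k + 1) (adQ k D) = 0.
Proof.
move=> [[linD _ _] _]; have [linQ _ _] := pQ_coder Q.
have lin0 (f : cofree P A -> cofree P A) : linear f -> f 0 = 0.
  by move=> lf; have := lf (-1) 0 0; rewrite scaler0 addr0 scaleN1r addNr.
have QQ x : pQ Q (pQ Q x) = 0.
  have := congr1 (@^~ x) (pQ_MC Q); rewrite /bracket /sgnz /= expr1 scaleN1r opprK.
  rewrite -mulr2n -scaler_nat => /eqP; rewrite scaler_eq0 => /orP[|/eqP //].
  by move/pcharf0P: charK => ->.
have linB (c : K) x y : pQ Q (x - c *: y) = pQ Q x - c *: pQ Q y.
  by have := linQ (- c) y x; rewrite !scaleNr [- _ + x]addrC => ->; rewrite addrC.
have sgnS : sgnz K (1 * (k + 1)) = - sgnz K (1 * k).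
  rewrite !mul1r /sgnz -signr_odd -(signr_odd _ `|k|%N) -signrN.
  by have -> : odd `|(k + 1)%R|%N = ~~ odd `|k|%N by lia.
apply/funext => x; rewrite /adQ /bracket linB sgnS !QQ (lin0 _ linD).
by rewrite scaler0 subr0 sub0r scaleNr opprK addNr.
Qed.

Lemma dEA_cls (charK : [pchar K] =i pred0) r p q D :
  dEA (page_cls _ _ r p q D) = page_cls _ _ _ _ _ (adQ (p + q) D).
Proof.
apply: page_diffE; [exact: Fcoder0|exact: adQ_linear|].
by move=> p' k x; exact: adQ_adQ.
Qed.

(* euler_class xi, for xi in E_r: starting from e_A in E_1^{0,0}, the          *)
(* differentials d_1, ..., d_{r-1} vanish successively on the elements defined *)
(* by e_A, and xi is the element of E_r^{0,0} that e_A defines.                *)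
Inductive euler_class : forall r, EA r 0 0 -> Prop :=
| euler_class1 : euler_class (page_cls _ _ 1 0 0 (@euler K P A))
| euler_class_next r (xi : EA r 0 0) (xi' : EA r.+1 0 0) of
    euler_class xi & dEA xi = 0 & page_next xi xi' : euler_class xi'.

(* K_A^{<= n} = [q_2 + 2 q_3 + ... + (n-1) q_n] in H^1(F^1 / F^(n+1)) *)
Definition kaledin_class (n : nat) : strip_H (@Fcoder K P A) adQ 1 (n.+1)%:Z 1 :=
  strip_cls _ _ _ _ _ (\sum_(2 <= i < n.+1) (i.-1)%:R *: pq Q i).

End Classes.

(* Main.v *)
Require Import Defs.
From mathcomp Require Import all_boot all_order all_algebra.
From mathcomp Require Import boolp functions zify.

Set Implicit Arguments.
Unset Strict Implicit.
Unset Printing Implicit Defensive.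

Import GRing.Theory.
(* [span] has to mean the closure under linear combinations, not the span of  *)
(* a sequence of vectors.                                                     *)
Import Defs.
Local Open Scope ring_scope.

(** The Kaledin class is the boundary of the Euler derivation. Counting degrees
in A, an operation of weight i and degree 1 with values in A[1] raises the total
degree of its i+1 arguments by 1 - i, so that [Q, e_A] = sum_i (i-1) q_i: modulo
F^(n+1), the cocycle that represents the truncated Kaledin class is [Q, e_A]
([euler_defect_F]). It is not a boundary for free, because e_A has weight 0
whereas the class lives in the cohomology of F^1/F^(n+1). The class vanishes
exactly when [Q, e_A] = [Q, y] modulo F^(n+1) for some degree 0 coderivation y
in F^1, that is, when some D in e_A + F^1 has [Q, D] in F^(n+1)
([kaledin_class_eq0]); such a D is called an Euler cycle of order n+1.

Euler cycles also compute the spectral sequence. If D has order n+1, it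
represents e_A on every page r <= n+1, since the difference e_A - D is in F^1
and so vanishes on the first page in filtration 0, and d_r kills its class for r <= n
([euler_cycle_class], [euler_cycle_dEA]). Conversely any element of page n that
e_A defines is the class of some D in e_A + F^1 ([euler_class_rep]), and
d_n [D] = 0 says that [Q, D] = [Q, W] modulo F^(n+1) for some W in F^1, so that
D - W has order n+1 ([dEA_euler_cycle]).

Both directions use that [Q, -] maps every coderivation into F^1
([adQ_F1]). This holds because Q has no component of weight 0: Q kills A[1], and
a coderivation maps A[1] to itself. That the bracket of two coderivations is
again one comes from the co-Leibniz rule, where the two mixed terms cancel
([coder_bracket]). *)

(** * Linear closure *)

Section SpanTheory.
Variables (K : fieldType) (M : lmodType K).
Implicit Types (P S : M -> Prop) (x y : M).

Lemma spanZ P a x : span P x -> span P (a *: x).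
Proof. by move=> Px; rewrite -[_ *: _]addr0; apply: span_lin Px (span_zero _). Qed.

Lemma spanD P x y : span P x -> span P y -> span P (x + y).
Proof. by move=> Px Py; rewrite -[x]scale1r; exact: span_lin. Qed.

Lemma spanB P x y : span P x -> span P y -> span P (x - y).
Proof. by move=> Px Py; rewrite addrC -scaleN1r; exact: span_lin. Qed.

Lemma span_sum P (I : eqType) (s : seq I) (F : I -> M) :
  (forall i, i \in s -> span P (F i)) -> span P (\sum_(i <- s) F i).
Proof.
move=> PF; rewrite big_seq; elim/big_ind: _ => //; first exact: span_zero.
exact: spanD.
Qed.

Lemma span_closed_ind P S x : S 0 -> (forall a u v, S u -> S v -> S (a *: u + v)) ->
  (forall u, P u -> S u) -> span P x -> S x.
Proof. by move=> S0 Slin PS; elim=> [u /PS||a u v _ Su _ Sv] //; exact: Slin. Qed.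

Lemma cls_eq0 P x : cls P x = 0 <-> span P x.
Proof. by rewrite -[X in _ = X](cls0 P) cls_eq subr0. Qed.

End SpanTheory.

Lemma linear_fun0 (K : fieldType) (M N : lmodType K) (f : M -> N) :
  linear f -> f 0 = 0.
Proof. by move=> lf; have := lf (-1) 0 0; rewrite scaler0 addr0 scaleN1r addNr. Qed.

Lemma linear_funZ (K : fieldType) (M N : lmodType K) (f : M -> N) a x :
  linear f -> f (a *: x) = a *: f x.
Proof. by move=> lf; rewrite -[a *: x]addr0 lf linear_fun0 // addr0. Qed.

Lemma linear_funB (K : fieldType) (M N : lmodType K) (f : M -> N) x y :
  linear f -> f (x - y) = f x - f y.
Proof. by move=> lf; rewrite addrC -scaleN1r lf scaleN1r addrC. Qed.

Lemma sgnzD (K : fieldType) (i j : int) : sgnz K (i + j) = sgnz K i * sgnz K j.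
Proof.
rewrite /sgnz -exprD -signr_odd -[RHS]signr_odd.
by have -> : odd `|(i + j)%R|%N = odd (`|i| + `|j|)%N by lia.
Qed.

Lemma sgnz_sqr (K : fieldType) (i : int) : sgnz K i * sgnz K i = 1.
Proof. by rewrite -expr2 /sgnz -exprM mulnC exprM sqrrN expr1n expr1n. Qed.

Lemma size_leaves E X (t : tree E X) : size (leaves t) = (nodes t).+1.
Proof. by elim: t => //= e l IHl r IHr; rewrite size_cat IHl IHr addnS. Qed.

Lemma leaves_tmap E X Y (f : X -> Y) (t : tree E X) :
  leaves (tmap f t) = map f (leaves t).
Proof. by elim: t => //= e l -> r ->; rewrite map_cat. Qed.

(** * The cofree coalgebra and its two gradings *)

Section Cotrees.
Variables (K : fieldType) (P : quadratic_data K) (A : int -> lmodType K).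
Notation cotree := (cotree P A).
Notation cofree := (cofree P A).
Notation E' := (twist (qE P)).
Notation homog := (homog A).
Implicit Types (x y z : cotree) (t : tree E' homog).

Lemma nodeZl (e : E') a x y : node e (a *: x) y = a *: node e x y.
Proof. by have := linear_funZ a x (node_linearl e y). Qed.

Lemma nodeZr (e : E') a x y : node e x (a *: y) = a *: node e x y.
Proof. by have := linear_funZ a y (node_linearr e x). Qed.

Lemma nodeBl (e : E') x x' y : node e (x - x') y = node e x y - node e x' y.
Proof. by have := linear_funB x x' (node_linearl e y). Qed.

Lemma nodeBr (e : E') x y y' : node e x (y - y') = node e x y - node e x y'.
Proof. by have := linear_funB y y' (node_linearr e x). Qed.

Definition cogen_proj : cotree -> cotree :=
  mag_lift (fun t => if nodes t is 0 then tgen _ _ t else 0).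

Lemma cogen_proj_rel s : mag_rel (@sdeg K A) (@leaf_rel K P A) s ->
  \sum_(kt <- s) kt.1 *:
    (if nodes kt.2 is 0 then tgen (@sdeg K A) (@leaf_rel K P A) kt.2 else 0) = 0.
Proof.
case=> [{}s hs|k e f l r|e l r|e {}s r _|e l {}s _].
- have /fval_rel := mag_base (@sdeg K A) hs; rewrite /fval => h; rewrite -[RHS]h {h}.
  by move: hs => [i [k [u [w ->]]]]; rewrite !big_cons !big_nil.
- by rewrite !big_cons big_nil /= !scaler0 !addr0.
- by rewrite !big_cons big_nil /= !scaler0 !addr0.
- by rewrite big_map big1 // => kt _; rewrite /= scaler0.
by rewrite big_map big1 // => kt _; rewrite /= scaler0.
Qed.

Lemma cogen_proj_linear : linear cogen_proj.
Proof. exact: (mag_liftP cogen_proj_rel).1. Qed.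

Lemma cogen_proj_tgen t : cogen_proj (tgen _ _ t) = if nodes t is 0 then tgen _ _ t else 0.
Proof. by rewrite /cogen_proj (mag_liftP cogen_proj_rel).2. Qed.

Lemma weight0_ker_pr x : weight 0 x -> ker_pr x -> x = 0.
Proof.
move=> wx kx; have <- : cogen_proj x = x.
  apply: (span_closed_ind (S := fun y => cogen_proj y = y)) wx => [|a u v hu hv|_ [t t0 ->]].
  - exact: linear_fun0 cogen_proj_linear.
  - by rewrite cogen_proj_linear hu hv.
  by rewrite cogen_proj_tgen t0.
apply: (span_closed_ind (S := fun y => cogen_proj y = 0)) kx => [|a u v hu hv|_ [t t0 ->]].
- exact: linear_fun0 cogen_proj_linear.
- by rewrite cogen_proj_linear hu hv scaler0 addr0.
by rewrite cogen_proj_tgen; case: nodes t0.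
Qed.

(** Weight and degree are prescribed together, tree by tree, so that the Euler
derivation acts by a scalar. *)
Definition bihom i d : cotree -> Prop :=
  tspan (fun t => nodes t = i /\ tdeg (@sdeg K A) t = d).

Lemma tdegA_bihom t : tdegA t = tdeg (@sdeg K A) t + (nodes t).+1%:Z.
Proof.
rewrite /tdegA big_split /= -size_leaves; congr (_ + _).
by elim: leaves => [|a s IHs]; rewrite ?big_nil // big_cons IHs /=; lia.
Qed.

(** The coalgebra is spanned by elements of pure weight and degree: evaluating an
m-ary cooperation on homogeneous arguments gives trees with m leaves, hence m-1
vertices, all carrying the same arguments. *)
Lemma cofree_ind (S : cofree -> Prop) :
  S 0 -> (forall a u v, S u -> S v -> S (a *: u + v)) ->
  (forall i d (u : cofree), bihom i d (val u) -> S u) -> forall u, S u.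
Proof.
move=> S0 Slin Shom [x hx]; have sx : span (@cofree_gen K P A) x by apply/asboolP.
suff [y yx] : exists2 y : cofree, val y = x & S y.
  by have -> : Submod hx = y by apply: val_inj; rewrite yx.
elim: sx {hx} => [{}x gx||a u v _ [y <- Sy] _ [z <- Sz]]; last 2 first.
- by exists 0.
- by exists (a *: y + z); last exact: Slin.
have hx : x \in span_pred (@cofree_gen K P A) by apply/asboolP/span_gen.
exists (Submod hx) => //; case: gx => [m [c [v [hc _ xE]]]].
apply: (Shom m.-1 (\sum_(j <- iota 0 m) sdeg (v j))); rewrite /= xE.
apply: span_sum => kt /(allP hc) /andP[_ perm_t]; apply: spanZ; apply: span_gen.
exists (tmap v kt.2) => //; split; last first.
  by rewrite /tdeg leaves_tmap big_map (perm_big _ perm_t).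
have := size_leaves (tmap v kt.2).
by rewrite leaves_tmap size_map (perm_size perm_t) size_iota => ->.
Qed.

Lemma bihom_weight i d x : bihom i d x -> weight i x.
Proof.
apply: span_closed_ind => [|a u v|_ [t [ti _] ->]]; first exact: span_zero.
  exact: span_lin.
by apply: span_gen; exists t.
Qed.

Lemma bihom_hdeg i d x : bihom i d x -> hdeg d x.
Proof.
apply: span_closed_ind => [|a u v|_ [t [_ td] ->]]; first exact: span_zero.
  exact: span_lin.
by apply: span_gen; exists t.
Qed.

(** The degree in A of a tensor of i+1 factors exceeds its degree in A[1] by i+1. *)
Lemma eulerT_bihom i d x : bihom i d x -> eulerT x = (d + i.+1%:Z)%:~R *: x.
Proof.
apply: (span_closed_ind (S := fun y => eulerT y = _ *: y)) => [|a u v hu hv|_ [t [ti td] ->]].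
- by rewrite (linear_fun0 (@eulerT_linear _ _ _)) scaler0.
- by rewrite eulerT_linear hu hv scalerDr !scalerA mulrC.
by rewrite eulerT_tgen tdegA_bihom ti td.
Qed.

(** Only the terms in A[1] matter after projection, and on them the two degrees
differ by 1, whatever the weights of the other terms. *)
Lemma eulerT_pr d x : hdeg d x -> ker_pr (eulerT x - (d + 1)%:~R *: x).
Proof.
apply: (span_closed_ind (S := fun y => ker_pr (eulerT y - _ *: y))) => [|a u v hu hv|_ [t td ->]].
- rewrite (linear_fun0 (@eulerT_linear _ _ _)) scaler0 subr0; exact: span_zero.
- rewrite eulerT_linear scalerDr opprD addrACA scalerA mulrC -scalerA -scalerBr.
  exact: span_lin.
rewrite eulerT_tgen tdegA_bihom td; case t0: (nodes t) => [|j].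
  by rewrite subrr; exact: span_zero.
by apply: spanB; apply: spanZ; apply: span_gen; exists t; rewrite ?t0.
Qed.

End Cotrees.

(** * Brackets of coderivations *)

Section Coderivations.
Variables (K : fieldType) (P : quadratic_data K) (A : int -> lmodType K).
Notation cofree := (cofree P A).
Notation E' := (twist (qE P)).
Implicit Types (D : cofree -> cofree) (k l p : int).

Lemma coder_lin k a D D' : coder k D -> coder k D' -> coder k (a *: D + D').
Proof.
move=> [lD hD cD] [lD' hD' cD']; split=> [b x y|d x hx|x v r hv hr hx].
- rewrite -[LHS]/(a *: D (b *: x + y) + D' (b *: x + y)) lD lD'.
  rewrite -[RHS]/(b *: (a *: D x + D' x) + (a *: D y + D' y)).
  by rewrite !scalerDr addrACA !scalerA [a * b]mulrC.
- by apply: span_lin; [exact: hD | exact: hD'].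
have -> : \sum_(p <- r) cot_der k (a *: D + D') p =
    a *: (\sum_(p <- r) cot_der k D p) + \sum_(p <- r) cot_der k D' p.
  rewrite scaler_sumr -big_split; apply: eq_bigr => -[[[e d] y] z] _ /=.
  rewrite node_linearl node_linearr !scalerDr !scalerA.
  by rewrite addrACA [_ * a]mulrC.
rewrite /= opprD addrACA -scalerBr.
by apply: span_lin; [exact: cD hx | exact: cD' hx].
Qed.

Lemma Fcoder_lin p k a D D' :
  Fcoder p k D -> Fcoder p k D' -> Fcoder p k (a *: D + D').
Proof.
move=> [cD FD] [cD' FD']; split=> [|i x ip hx]; first exact: coder_lin.
by apply: span_lin; [exact: FD hx | exact: FD' hx].
Qed.

Lemma FcoderD p k D D' : Fcoder p k D -> Fcoder p k D' -> Fcoder p k (D + D').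
Proof. by rewrite -[D in D + _]scale1r; exact: Fcoder_lin. Qed.

Lemma FcoderN p k D : Fcoder p k D -> Fcoder p k (- D).
Proof.
move=> FD; rewrite -[- D]addr0 -scaleN1r; apply: Fcoder_lin FD _.
exact: Fcoder0.
Qed.

Lemma FcoderB p k D D' : Fcoder p k D -> Fcoder p k D' -> Fcoder p k (D - D').
Proof. by move=> FD FD'; apply: FcoderD FD (FcoderN FD'). Qed.

Lemma Fcoder_sum p k (I : Type) (s : seq I) (F : I -> cofree -> cofree) :
  (forall i, Fcoder p k (F i)) -> Fcoder p k (\sum_(i <- s) F i).
Proof.
by move=> FF; elim/big_ind: _ => // [|D D']; [exact: Fcoder0 | exact: FcoderD].
Qed.

Lemma Fcoder_le p p' k D : p <= p' -> Fcoder p' k D -> Fcoder p k D.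
Proof. by move=> pp' [cD FD]; split=> // i x ip; apply: FD; lia. Qed.

Lemma Fcoder_cast p p' k k' D :
  p = p' -> k = k' -> Fcoder p k D -> Fcoder p' k' D.
Proof. by move=> -> ->. Qed.

Lemma coder_Fcoder0 k D : coder k D -> Fcoder 0 k D.
Proof. by move=> cD; split=> // i x; lia. Qed.

(** The cooperations vanish on A[1], so the co-Leibniz rule leaves no other term. *)
Lemma coder_weight0 k D (x : cofree) :
  coder k D -> weight 0 (val x) -> weight 0 (val (D x)).
Proof.
move=> [_ _ cD] x0; have := cD x (val x) [::] x0.
by rewrite !big_nil addr0 subr0; apply.
Qed.

(** The value of the composite of D and D' on a cooperation, obtained by applying
the co-Leibniz rule twice; the two middle terms are those which the graded
commutator cancels. *)
Definition cot_comp k l D D' (p : cotensor P A) : cotree P A :=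
  let: (e, d, y, z) := p in
  node e (val (D (D' y))) (val z)
  + sgnz K (k * (d + l)) *: node e (val (D' y)) (val (D z))
  + sgnz K (l * d) *: node e (val (D y)) (val (D' z))
  + sgnz K ((k + l) * d) *: node e (val y) (val (D (D' z))).

Lemma coder_comp k l D D' (x : cofree) v (r : seq (cotensor P A)) :
  coder k D -> coder l D' -> weight 0 v ->
  (forall e d y z, (e, d, y, z) \in r -> hdeg d (val y)) ->
  val x = v + \sum_(p <- r) cot_val p ->
  weight 0 (val (D (D' x)) - \sum_(p <- r) cot_comp k l D D' p).
Proof.
move=> [lD _ cD] [_ hD' cD'] hv hr hx; have v'0 := cD' x v r hv hr hx.
(* [cot_der l D' p] is again a sum of two cooperations; the sign of the second *)
(* is absorbed in its last factor.                                            *)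
pose ext (p : cotensor P A) : seq (cotensor P A) := let: (e, d, y, z) := p in
  [:: (e, d + l, D' y, z); (e, d, y, sgnz K (l * d) *: D' z)].
have := cD (D' x) _ (flatten (map ext r)) v'0.
have -> : \sum_(p <- flatten (map ext r)) cot_der k D p =
    \sum_(p <- r) cot_comp k l D D' p.
  rewrite big_flatten big_map; apply: eq_bigr => -[[[e d] y] z] _.
  rewrite /ext big_cons big_seq1 /cot_der (linear_funZ _ _ lD) /= !nodeZr.
  by rewrite scalerA -sgnzD -mulrDl -!addrA.
apply=> [e d y z /flattenP[_ /mapP[[[[e' d'] y'] z'] hp ->]]|].
  have hy' := hr _ _ _ _ hp.
  by rewrite !inE => /orP[/eqP[_ -> -> _]|/eqP[_ -> -> _]] //; exact: hD'.
rewrite big_flatten big_map [X in _ + X](_ : _ = \sum_(p <- r) cot_der l D' p).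
  by rewrite subrK.
apply: eq_bigr => -[[[e d] y] z] _.
by rewrite /ext big_cons big_seq1 /= nodeZr.
Qed.

Lemma coder_bracket k l D D' :
  coder k D -> coder l D' -> coder (k + l) (bracket k l D D').
Proof.
move=> cD cD'; have [lD hD _] := cD; have [lD' hD' _] := cD'.
split=> [a x y|d x hx|x v r hv hr hx].
- rewrite /bracket lD' lD lD' lD scalerDr opprD addrACA scalerBr.
  by rewrite !scalerA [a * _]mulrC.
- apply: spanB; last apply: spanZ.
    by rewrite addrA addrAC; apply: hD; apply: hD'.
  by rewrite addrA; apply: hD'; apply: hD.
have -> : \sum_(p <- r) cot_der (k + l) (bracket k l D D') p =
    \sum_(p <- r) cot_comp k l D D' p
    - sgnz K (k * l) *: \sum_(p <- r) cot_comp l k D' D p.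
  rewrite scaler_sumr -sumrB; apply: eq_bigr => -[[[e d] y] z] _ /=.
  rewrite nodeBl nodeZl nodeBr nodeZr [l + k]addrC.
  rewrite !scalerDr !mulrDr !sgnzD [l * k]mulrC !scalerN !scalerA.
  set s := sgnz K (k * l); set sk := sgnz K (k * d); set sl := sgnz K (l * d).
  have -> : s * (sl * s) = sl by rewrite mulrCA /s sgnz_sqr mulr1.
  rewrite [sk * s]mulrC [sgnz K ((k + l) * d) * s]mulrC.
  (* Both composites contain the same two mixed terms, in opposite orders. *)
  rewrite [X in _ = X - _](ACl (1*4*(2*3))) [X in _ = _ - X](ACl (1*4*(3*2))).
  by rewrite addrACA -opprD [in RHS]opprD [RHS]addrACA subrr addr0.
have -> : val (bracket k l D D' x) = val (D (D' x)) - sgnz K (k * l) *: val (D' (D x)).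
  by [].
rewrite opprD addrACA -opprD -scalerBr.
apply: spanB; first exact: coder_comp cD cD' hv hr hx.
by apply: spanZ; exact: coder_comp cD' cD hv hr hx.
Qed.

End Coderivations.

(** * The Kaledin cocycle as the boundary of the Euler derivation *)

Section Euler.
Variables (K : fieldType) (P : quadratic_data K) (A : int -> lmodType K).
Variable Q : minimal_Pinfty P A.
Notation cofree := (cofree P A).
Notation euler := (@euler K P A).
Implicit Types (D : cofree -> cofree) (x : cofree).

Lemma adQ_coder k D : coder k D -> coder (k + 1) (adQ Q k D).
Proof. by rewrite addrC => cD; apply: coder_bracket cD; exact: pQ_coder. Qed.

Lemma pQ_weight0 x : weight 0 (val x) -> pQ Q x = 0.
Proof.
move=> x0; apply/val_inj/weight0_ker_pr; first exact: coder_weight0 (pQ_coder Q) x0.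
by have := pQ_sum Q x0; rewrite pq0 subr0.
Qed.

Lemma adQ_weight0 k D x : coder k D -> weight 0 (val x) -> adQ Q k D x = 0.
Proof.
move=> cD x0; have [lD _ _] := cD; rewrite /adQ /bracket !pQ_weight0 //.
  by rewrite (linear_fun0 lD) scaler0 subr0.
exact: coder_weight0 cD x0.
Qed.

(** No component of [Q, D] has weight 0, even when D has one: the complex A has
zero differential. *)
Lemma adQ_F1 k D : coder k D -> Fcoder 1 (k + 1) (adQ Q k D).
Proof.
move=> cD; split=> [|[|i] x // _ x0]; first exact: adQ_coder.
by rewrite (adQ_weight0 cD x0); exact: span_zero.
Qed.

Lemma euler_coder0 : coder 0 euler.
Proof. by have [] := euler_coder P A. Qed.

(** With x of weight i and degree d, e_A is d+i+1 on x, and it is d+2 on the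
projection of Q x, which has degree d+1. The difference is i-1. For i = 0, where
the predecessor is not i-1, both sides vanish. *)
Lemma adQ_euler_bihom i d x : bihom i d (val x) ->
  ker_pr (val (adQ Q 0 euler x - (i.-1)%:R *: pQ Q x)).
Proof.
move=> hx; have [lQ hQ _] := pQ_coder Q; case: i hx => [|i] hx.
  have x0 := bihom_weight hx.
  rewrite (adQ_weight0 euler_coder0 x0) scale0r subr0.
  exact: span_zero.
have eux : euler x = (d + i.+2%:Z)%:~R *: x by apply/val_inj/eulerT_bihom.
have -> : val (adQ Q 0 euler x - i%:R *: pQ Q x) =
    - (eulerT (val (pQ Q x)) - (d + 1 + 1)%:~R *: val (pQ Q x)).
  rewrite /adQ /bracket eux (linear_funZ _ _ lQ) /= mulr0 scale1r opprB.
  rewrite addrAC -scalerBl; congr (_ *: _ - _).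
  by rewrite -[i%:R]/(i%:~R) -intrB; congr _%:~R; lia.
rewrite -sub0r; apply: spanB; first exact: span_zero.
by apply: eulerT_pr; apply: hQ; exact: bihom_hdeg hx.
Qed.

(** The error in replacing the Kaledin cocycle, truncated at n, by [Q, e_A]. *)
Definition euler_defect n : cofree -> cofree :=
  adQ Q 0 euler - \sum_(2 <= i < n) (i.-1)%:R *: pq Q i.

Lemma euler_defect_coder n : coder 1 (euler_defect n).
Proof.
have F0 D : coder 1 D -> Fcoder 0 1 D by exact: coder_Fcoder0.
have /F0 FQe : coder 1 (adQ Q 0 euler) := adQ_coder euler_coder0.
suff [] : Fcoder 0 1 (euler_defect n) by [].
apply: FcoderB FQe _; apply: Fcoder_sum => i.
rewrite -[_ *: _]addr0; apply: Fcoder_lin (Fcoder0 _ _ _ _).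
by apply: F0; have [] := pq_coder Q i.
Qed.

(** On weight i only q_i contributes, and its projection is that of Q. The index
i may be below 2, because the coefficient then vanishes. *)
Lemma sum_pq_pr i n x : weight i (val x) -> (i < n)%N ->
  ker_pr (val (\sum_(2 <= j < n) (j.-1)%:R *: pq Q j x - (i.-1)%:R *: pQ Q x)).
Proof.
move=> hx lt_in.
have pq_ker j : j != i -> ker_pr (val ((j.-1)%:R *: pq Q j x)).
  move=> neq_ji; apply: spanZ; have [_ wq] := pq_coder Q j.
  by apply: wq hx; rewrite eq_sym.
have sum_ker (s : seq nat) : i \notin s ->
    ker_pr (val (\sum_(j <- s) (j.-1)%:R *: pq Q j x)).
  move=> iNs; rewrite raddf_sum; apply: span_sum => j js; apply: pq_ker.
  by apply: contraNneq iNs => <-.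
have [i_lt2|i_ge2] := ltnP i 2.
  have -> : i.-1 = 0%N by lia.
  by rewrite scale0r subr0; apply: sum_ker; rewrite mem_index_iota; lia.
rewrite (bigD1_seq i) ?iota_uniq ?mem_index_iota ?i_ge2 //= -big_filter.
rewrite addrAC -scalerBr; apply: spanD; last first.
  by apply: sum_ker; rewrite mem_filter eqxx.
rewrite -opprB scalerN -scaleN1r; do 2!apply: spanZ; exact: pQ_sum.
Qed.

Lemma euler_defectE n x : euler_defect n x =
  adQ Q 0 euler x - \sum_(2 <= j < n) (j.-1)%:R *: pq Q j x.
Proof. by congr (_ - _); elim/big_ind2: _ => // D u D' v <- <-. Qed.

(** An arbitrary element mixes finitely many weights, so the truncation order that
makes the projection of the defect vanish depends on it. In this form the claim
passes to linear combinations of elements of pure weight and degree; an element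
of weight i is such a combination, possibly with terms of other weights. *)
Lemma euler_defect_pr x : exists m, forall n, (m <= n)%N ->
  ker_pr (val (euler_defect n x)).
Proof.
elim/cofree_ind: x => [|a u v [m hm] [m' hm']|i d x hx].
- exists 0%N => n _; have [lG _ _] := euler_defect_coder n.
  by rewrite (linear_fun0 lG); exact: span_zero.
- exists (maxn m m') => n; rewrite geq_max => /andP[mn mn'].
  have [-> _ _] := euler_defect_coder n.
  by apply: span_lin; [exact: hm | exact: hm'].
exists i.+1 => n lt_in.
have -> : euler_defect n x = (adQ Q 0 euler x - (i.-1)%:R *: pQ Q x)
    - (\sum_(2 <= j < n) (j.-1)%:R *: pq Q j x - (i.-1)%:R *: pQ Q x).
  by rewrite euler_defectE opprB addrA subrK.
apply: spanB; first exact: adQ_euler_bihom hx.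
exact: sum_pq_pr (bihom_weight hx) lt_in.
Qed.

(** On elements of weight i < n, raising the truncation order beyond n does not
change the projection to the cogenerators. *)
Lemma euler_defect_F n : Fcoder n%:Z 1 (euler_defect n).
Proof.
split=> [|i x]; first exact: euler_defect_coder.
rewrite ltz_nat => lt_in hx.
have [m /(_ (maxn m n))] := euler_defect_pr x.
rewrite leq_maxl => /(_ isT).
have -> : val (euler_defect n x) = val (euler_defect (maxn m n) x)
    + val (\sum_(2 <= j < maxn m n) (j.-1)%:R *: pq Q j x - (i.-1)%:R *: pQ Q x)
    - val (\sum_(2 <= j < n) (j.-1)%:R *: pq Q j x - (i.-1)%:R *: pQ Q x).
  rewrite -raddfD -raddfB; congr val; rewrite !euler_defectE.
  by rewrite addrA subrK opprB addrA subrK.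
move=> kx; apply: spanB; last exact: sum_pq_pr hx lt_in.
by apply: spanD kx _; apply: sum_pq_pr hx _; rewrite leq_max lt_in orbT.
Qed.

Lemma adQ_eulerB D : adQ Q 0 (euler - D) = adQ Q 0 euler - adQ Q 0 D.
Proof. exact: linear_funB (adQ_linear Q 0). Qed.

(** * Euler cycles and the spectral sequence *)

(** D corrects e_A, by a term of positive weight, to a cocycle modulo F^r. *)
Definition euler_cycle (r : nat) D : Prop :=
  Fcoder 1 0 (euler - D) /\ Fcoder r%:Z 1 (adQ Q 0 D).

Lemma kaledin_class_eq0 n :
  kaledin_class Q n = 0 <-> exists D, euler_cycle n.+1 D.
Proof.
pose s := \sum_(2 <= i < n.+1) (i.-1)%:R *: pq Q i.
have defect : adQ Q 0 euler = euler_defect n.+1 + s by rewrite /euler_defect subrK.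
have Fdefect := euler_defect_F n.+1.
rewrite /kaledin_class cls_eq0 -/s; split.
  have e0 : (1 - 1 : int) = 0 by [].
  move=> hs; have {hs} : strip_bnd (@Fcoder K P A) (adQ Q) 1 n.+1%:Z 1 s.
    apply: span_closed_ind hs => // [|a _ _ [D [F [FD FF ->]]] [D' [F' [FD' FF' ->]]]].
      exists 0, 0; split; rewrite ?(linear_fun0 (adQ_linear _ _)) ?addr0 //.
        exact: Fcoder0.
      exact: Fcoder0.
    exists (a *: D + D'), (a *: F + F'); split; try exact: Fcoder_lin.
    by rewrite adQ_linear scalerDr addrACA.
  rewrite /strip_bnd e0 => -[D [F [FD FF sE]]]; exists (euler - D); split.
    by rewrite subKr.
  by rewrite adQ_eulerB defect sE [_ + F]addrC addrA addrK; exact: FcoderD.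
move=> [D [FD FQD]].
apply: span_gen; exists (euler - D), (adQ Q 0 D - euler_defect n.+1).
split=> //; first exact: FcoderB.
rewrite -[adQ _ (1 - 1)]/(adQ Q 0) adQ_eulerB addrA subrK.
by rewrite defect addrC addKr.
Qed.

(** Two representatives of one class on page r differ by an element of F^1 and
a bracket [Q, z] with z of degree -1, which is in F^1 as well. *)
Lemma euler_class_rep r (xi : EA Q r 0 0) : euler_class xi ->
  exists2 D, xi = page_cls _ _ _ _ _ D & Fcoder 1 0 (euler - D).
Proof.
elim=> [|{}r {}xi xi' _ [D -> FD] _ [D' [_ DD' ->]]].
  by exists euler; rewrite // subrr; exact: Fcoder0.
exists D' => //; rewrite -[euler](subrK D) -addrA; apply: FcoderD FD _.
move/cls_eq: DD'; apply: span_closed_ind; first exact: Fcoder0.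
  by move=> a u v; exact: Fcoder_lin.
move=> _ [y [z [[Fy _] [[cz _] _] ->]]]; apply: FcoderD.
  by apply: Fcoder_cast Fy; lia.
have {}cz : coder (-1) z.
  by rewrite (_ : -1 = 0 - r%:Z + 1 + (0 + r%:Z - 2)) //; lia.
exact: adQ_F1 cz.
Qed.

Lemma euler_cycle_le r r' D : (r <= r')%N -> euler_cycle r' D -> euler_cycle r D.
Proof. by move=> le_rr' [FD FQD]; split=> //; apply: Fcoder_le FQD. Qed.

Lemma euler_cycle_coder r D : euler_cycle r D -> Fcoder 0 0 D.
Proof.
move=> [FD _]; rewrite -[D](subKr euler); apply: FcoderB; last exact: Fcoder_le FD.
exact: coder_Fcoder0 euler_coder0.
Qed.

Lemma cyc0 r p q : cyc (@Fcoder K P A) (adQ Q) r p q 0.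
Proof.
by split; rewrite ?(linear_fun0 (adQ_linear _ _)); exact: Fcoder0.
Qed.

Section CharZero.
Hypothesis charK : [pchar K] =i pred0.

Lemma euler_cycle_dEA r D : euler_cycle r.+1 D ->
  dEA (page_cls _ _ r 0 0 D : EA Q r 0 0) = 0.
Proof.
move=> cycD; have [_ FQD] := cycD; rewrite (dEA_cls _ charK) cls_eq0; apply: span_gen.
exists (adQ Q 0 D), 0; split; last by rewrite (linear_fun0 (adQ_linear _ _)) [RHS]addr0.
  split; first by apply: Fcoder_cast FQD; lia.
  have -> : 0 + r%:Z + 1 + (0 - r%:Z + 1 - 1) = 0 + 1 by lia.
  by rewrite (adQ_adQ _ charK (euler_cycle_coder cycD)); exact: Fcoder0.
exact: cyc0.
Qed.

(** The boundaries of page r in filtration r are F^(r+1) plus brackets [Q, W] with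
W in F^1, so such a W corrects D to the next order. *)
Lemma dEA_euler_cycle r D : Fcoder 1 0 (euler - D) ->
  dEA (page_cls _ _ r 0 0 D : EA Q r 0 0) = 0 ->
  exists D', euler_cycle r.+1 D'.
Proof.
move=> FD; rewrite (dEA_cls _ charK) cls_eq0 => hD.
have [W FW FDW] : exists2 W, Fcoder 1 0 W & Fcoder r.+1%:Z 1 (adQ Q 0 D - adQ Q 0 W).
  pose S X := exists2 W, Fcoder 1 0 W & Fcoder r.+1%:Z 1 (X - adQ Q 0 W).
  apply: (span_closed_ind (S := S)) hD => [|a u v|_ [y [z [[Fy _] [Fz _] ->]]]].
  - exists 0; first exact: Fcoder0.
    by rewrite (linear_fun0 (adQ_linear _ _)) subr0; exact: Fcoder0.
  - move=> [W FW FuW] [W' FW' FvW']; exists (a *: W + W'); first exact: Fcoder_lin.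
    by rewrite adQ_linear opprD addrACA -scalerBr; exact: Fcoder_lin.
  exists z; first by apply: Fcoder_cast Fz; lia.
  have -> : 0 + r%:Z + (0 - r%:Z + 1) - 1 = 0 by lia.
  by rewrite addrK; apply: Fcoder_cast Fy; lia.
exists (D - W); split; first by rewrite opprB addrA addrAC; exact: FcoderD.
by rewrite (linear_funB _ _ (adQ_linear Q 0)).
Qed.

(** On the first page D and e_A have the same class; afterwards D itself is the
common lift to all pages. *)
Lemma euler_cycle_class r D : euler_cycle r.+1 D ->
  euler_class (page_cls _ _ r.+1 0 0 D : EA Q r.+1 0 0).
Proof.
elim: r => [|r IHr] cycD.
  have [FD _] := cycD.
  have -> : page_cls _ _ 1 0 0 D = page_cls _ _ 1 0 0 euler :> EA Q 1 0 0.
    apply/esym/cls_eq/span_gen; exists (euler - D), 0; split; last first.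
    - by rewrite (linear_fun0 (adQ_linear _ _)) addr0.
    - exact: cyc0.
    split; first exact: FD.
    exact: adQ_F1 FD.1.
  exact: euler_class1.
apply: (euler_class_next (IHr (euler_cycle_le _ cycD))) => //.
  exact: euler_cycle_dEA.
exists D; split=> //; split; first exact: euler_cycle_coder cycD.
by have [_] := cycD.
Qed.

End CharZero.

End Euler.

Theorem theorem4p1 (K : fieldType) (charK : [pchar K] =i pred0)
    (P : quadratic_data K) (koszulP : koszul P)
    (A : int -> lmodType K) (Q : minimal_Pinfty P A)
    (n : nat) (n_ge1 : (1 <= n)%N) :
  kaledin_class Q n = 0
  <->
  (forall r : nat, (2 <= r <= n)%N ->
     exists xi : EA Q r 0 0, euler_class xi /\ dEA xi = 0).
Proof.
split=> [/kaledin_class_eq0[D [FD FQD]] r /andP[r_ge2 le_rn]|surv].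
  exists (page_cls _ _ r 0 0 D); case: r r_ge2 le_rn => // r _ lt_rn.
  have cycD r' (le_r'n : (r' <= n.+1)%N) := euler_cycle_le le_r'n (conj FD FQD).
  split; first exact/(euler_cycle_class charK)/cycD/ltnW.
  exact/(euler_cycle_dEA charK)/cycD.
have [n_ge2|n_lt2] := leqP 2 n; last first.
  have -> : n = 1%N by lia.
  by rewrite /kaledin_class big_nil; exact: cls0.
have [|xi [/euler_class_rep[D -> FD] dD]] := surv n; first by rewrite n_ge2 /=.
exact/kaledin_class_eq0/(dEA_euler_cycle charK FD dD).
Qed.
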